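(* Let $(\Omega,\Sigma,\mu)$ be a finite measure space and let $X$ be a real Banach space, regarded as a subspace of its bidual $X^{**}$ via the canonical embedding. Suppose that $(B_{X^*},w^* )$ is convex block compact. If $\nu:\Sigma\to X^{**}$ is a countably additive $\mu$-continuous vector measure such that $$\overline{\mathrm{co}(\mathcal{A}_\nu(A))}^{w^*}\cap X\neq\emptyset\quad\text{for every }A\in\Sigma\text{ with }\mu(A)>0,$$ then $\nu(\Sigma)\subseteq X$, i.e. $\nu(A)\in X$ for every $A\in\Sigma$.
   Context: A convex block subsequence of a sequence $(g_n)_{n\in\mathbb{N}}$ in a linear space is a sequence $(h_k)_{k\in\mathbb{N}}$ of the form $h_k=\sum_{n\in I_k}a_n g_n$, where $(I_k)_{k\in\mathbb{N}}$ is a sequence of finite subsets of $\mathbb{N}$ with $\max(I_k)<\min(I_{k+1})$ and $(a_n)_{n\in\mathbb{N}}$ is a sequence of non-negative real numbers such that $\sum_{n\in I_k}a_n=1$ for all $k\in\mathbb{N}$. $(B_{X^*},w^* )$ (the closed unit ball of $X^*$ with the weak$^*$ topology) is convex block compact if every sequence in $B_{X^*}$ admits a convex block subsequence which is weak$^*$-convergent. Countable additivity and $\mu$-continuity of $\nu$ are with respect to the norm of $X^{**}$ ($\mu$-continuous: $\|\nu(A)\|\to 0$ as $\mu(A)\to 0$). For $A\in\Sigma$ with $\mu(A)>0$, the average range is $$\mathcal{A}_\nu(A):=\Big\{\frac{\nu(B)}{\mu(B)}: B\in\Sigma,\ B\subseteq A,\ \mu(B)>0\Big\}.$$ $\mathrm{co}$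 denotes convex hull and, for subsets of $X^{**}$, $\overline{\,\cdot\,}^{w^*}$ denotes closure for the weak$^*$ topology $\sigma(X^{**},X^* )$. *)

(* Defs.v *)
From HB Require Import structures.
From mathcomp Require Import all_boot all_order all_algebra finmap.
From mathcomp Require Import all_classical all_reals all_analysis.

Set Implicit Arguments.
Unset Strict Implicit.
Unset Printing Implicit Defensive.

Import Order.TTheory GRing.Theory Num.Theory.
Import numFieldNormedType.Exports.

Local Open Scope classical_set_scope.
Local Open Scope ring_scope.

Section dual.
Context {R : realType} (V : normedModType R).

Definition dual_pred : {pred V -> R^o} :=
  fun f => `[< linear f /\ continuous f >].

Lemma dual_submod_closed : submod_closed dual_pred.
Proof.
split.
  apply/asboolP; split; last exact: cst_continuous.
  by move=> a x y; rewrite /GRing.zero /= scaler0 addr0.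
move=> a f g /asboolP[lf cf] /asboolP[lg cg]; apply/asboolP; split.
  move=> b x y; have -> z : (a *: f + g) z = a *: f z + g z by [].
  have -> : (a *: f + g) x = a *: f x + g x by [].
  have -> : (a *: f + g) y = a *: f y + g y by [].
  by rewrite lf lg !scalerDr !scalerA (mulrC a b) addrACA.
move=> x; apply: (@continuousD R R^o V (a *: f) g); last exact: cg.
by apply: continuousZl_tmp; exact: cf.
Qed.

HB.instance Definition _ :=
  GRing.isSubmodClosed.Build R (V -> R^o) dual_pred dual_submod_closed.

Record dual := Dual { dual_fun :> V -> R^o; _ : dual_fun \in dual_pred }.

HB.instance Definition _ := [isSub for dual_fun].
HB.instance Definition _ := [Choice of dual by <:].
HB.instance Definition _ := [SubChoice_isSubLmodule of dual by <:].

Lemma dual_linear (f : dual) : linear f.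
Proof. by have /asboolP[] := valP f. Qed.

HB.instance Definition _ (f : dual) :=
  GRing.isLinear.Build R V R^o *:%R f (dual_linear f).

Lemma dual_continuous (f : dual) : continuous f.
Proof. by have /asboolP[] := valP f. Qed.

Lemma dual_eqP (f g : dual) : f =1 g -> f = g.
Proof. by move=> fg; apply/val_inj/funext. Qed.

Definition dual_norm (f : dual) : R :=
  sup [set `|f x| | x in [set x | `|x| <= 1]].

Lemma dual_has_sup (f : dual) :
  has_sup [set `|f x| | x in [set x : V | `|x| <= 1]].
Proof.
split; first by exists `|f 0|, 0 => //=; rewrite normr0.
have /linear_boundedP/pinfty_ex_gt0[r r0 fr] :=
  continuous_linear_bounded 0 (@dual_continuous f 0).
exists r => _ [x /= x1 <-]; apply: (le_trans (fr x)).
by rewrite ler_piMr// ltW.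
Qed.

Lemma dual_norm_ub (f : dual) (x : V) : `|x| <= 1 -> `|f x| <= dual_norm f.
Proof. by move=> x1; apply: (ub_le_sup (dual_has_sup f).2); exists x. Qed.

Lemma dual_norm_le (f : dual) (c : R) :
  (forall x : V, `|x| <= 1 -> `|f x| <= c) -> dual_norm f <= c.
Proof.
by move=> fc; apply: ge_sup (dual_has_sup f).1 _ => _ [x /= /fc + <-].
Qed.

Lemma dual_norm_ge0 (f : dual) : 0 <= dual_norm f.
Proof. by apply: le_trans (dual_norm_ub f (x := 0) _); rewrite ?normr0. Qed.

Lemma le_dual_norm (f : dual) (x : V) : `|f x| <= dual_norm f * `|x|.
Proof.
have [->|x0] := eqVneq x 0; first by rewrite linear0 !normr0 mulr0.
have nx0 : `|x| != 0 by rewrite normr_eq0.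
rewrite -[in leLHS](scale1r x) -(mulfV nx0) -scalerA linearZ normrM normr_id.
rewrite mulrC ler_wpM2r// dual_norm_ub// normrZ normfV normr_id.
by rewrite mulVf.
Qed.

Lemma dual_ler_normD (f g : dual) :
  dual_norm (f + g) <= dual_norm f + dual_norm g.
Proof.
apply: dual_norm_le => x x1; apply: le_trans (ler_normD (f x) (g x)) _.
by apply: lerD; exact: dual_norm_ub.
Qed.

Lemma dual_normrZ (a : R) (f : dual) : dual_norm (a *: f) = `|a| * dual_norm f.
Proof.
have le b g : dual_norm (b *: g) <= `|b| * dual_norm g.
  apply: dual_norm_le => x x1; have -> : (b *: g) x = b * g x by [].
  by rewrite normrM ler_wpM2l ?dual_norm_ub.
apply/eqP; rewrite eq_le le/=; have [->|a0] := eqVneq a 0.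
  by rewrite normr0 mul0r dual_norm_ge0.
rewrite -ler_pdivlMl ?normr_gt0// -normfV.
by have := le a^-1 (a *: f); rewrite scalerA mulVf// scale1r.
Qed.

Lemma dual_normr0_eq0 (f : dual) : dual_norm f = 0 -> f = 0.
Proof.
move=> f0; apply: dual_eqP => x; apply/eqP; rewrite -normr_le0.
by have := le_dual_norm f x; rewrite f0 mul0r.
Qed.

HB.instance Definition _ :=
  Lmodule_isNormed.Build R dual dual_ler_normD dual_normrZ dual_normr0_eq0.

End dual.

Section weak_star.
Context {R : realType} (V : normedModType R).

(* The dual of [V] with the topology of pointwise convergence on [V].
   For [V := dual X] this is the topology sigma(X**, X* ). *)
Definition weak_star : Type :=
  initial_topology (@dual_fun R V : dual V -> {ptws V -> R^o}).

HB.instance Definition _ := Topological.on weak_star.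

Lemma weak_star_cvgP (F : set_system weak_star) (f : weak_star) : Filter F ->
  F --> f <-> forall x : V, (fun g : dual V => g x) @ F --> (f : dual V) x.
Proof.
move=> FF.
pose val_ := (@dual_fun R V : weak_star -> {ptws V -> R^o}).
pose G : set_system {ptws V -> R^o} := val_ @ F.
have FG : Filter G by exact: fmap_filter.
have -> : F --> f <-> {ptws, G --> (f : dual V)}.
  split=> [Ff|Gf A /= [_ [[B Bop <-] Bfs sBfA]]].
    apply: (cvg_comp (idfun : weak_star -> weak_star) val_ Ff).
    exact: initial_continuous.
  have FB : G B by apply: Gf; exact: open_nbhs_nbhs.
  by apply: (@filterS _ F _ _ _ _ FB).
exact: (@pointwise_cvgP V R^o G (f : dual V) FG).
Qed.

Definition weak_star_closure (A : set (dual V)) : set (dual V) :=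
  @closure weak_star A.

End weak_star.

Section bidual.
Context {R : realType} (V : normedModType R).

Definition dual_eval (x : V) : dual V -> R^o := fun f => f x.

Lemma dual_eval_linear (x : V) : linear (dual_eval x).
Proof. by []. Qed.

HB.instance Definition _ (x : V) :=
  GRing.isLinear.Build R (dual V) R^o *:%R (dual_eval x) (dual_eval_linear x).

Lemma dual_evalP (x : V) : dual_eval x \in @dual_pred R (dual V).
Proof.
apply/asboolP; split; first exact: dual_eval_linear.
apply: bounded_linear_continuous; apply/linear_boundedP.
exists `|x|; split=> [|r /ltW xr f]; first exact: normr_real.
by rewrite (le_trans (le_dual_norm f x))// mulrC ler_wpM2r// dual_norm_ge0.
Qed.

Definition to_bidual (x : V) : dual (dual V) := Dual (dual_evalP x).

End bidual.

(* Since [\sum_(n <- I k) a n = 1], each [I k] is nonempty, so the second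
   condition says max (I k) < min (I k.+1). *)
Definition convex_block_subsequence (R : realType) (E : lmodType R)
    (g h : nat -> E) : Prop :=
  exists (I : nat -> {fset nat}) (a : nat -> R),
  [/\ forall n, 0 <= a n,
      forall k m n, m \in I k -> n \in I k.+1 -> (m < n)%N,
      forall k, \sum_(n <- I k) a n = 1 &
      forall k, h k = \sum_(n <- I k) a n *: g n].

Definition dual_ball_convex_block_compact (R : realType) (V : normedModType R)
    : Prop :=
  forall g : nat -> dual V, (forall n, `|g n| <= 1) ->
  exists2 h : nat -> dual V, convex_block_subsequence g h &
  exists f : weak_star V, (h : nat -> weak_star V) @ \oo --> f.

Definition convex_hull (R : numDomainType) (M : lmodType R) (A : set M)
    : set M :=
  smallest (@convex_set R M) A.

Section vector_measure.
Context {d : measure_display} {T : measurableType d} {R : realType}.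
Context {W : normedModType R}.
Variables (mu : {finite_measure set T -> \bar R}) (nu : set T -> W).

Definition countably_additive : Prop :=
  forall A : nat -> set T, (forall n, measurable (A n)) -> trivIset setT A ->
  series (nu \o A) @ \oo --> nu (\bigcup_n A n).

Definition measure_continuous : Prop :=
  forall e : R, 0 < e -> exists2 r : R, 0 < r &
  forall A, measurable A -> (mu A < r%:E)%E -> `|nu A| < e.

Definition average_range (A : set T) : set W :=
  [set (fine (mu B))^-1 *: nu B | B in
    [set B | [/\ measurable B, B `<=` A & (0 < mu B)%E]]].

End vector_measure.

(* Main.v *)
Require Import Defs.
From HB Require Import structures.
From mathcomp Require Import all_boot all_order all_algebra finmap.
From mathcomp Require Import all_classical all_reals all_analysis.
From mathcomp Require Import measurable_realfun ring lra.

Set Implicit Arguments.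
Unset Strict Implicit.
Unset Printing Implicit Defensive.

Import Order.TTheory GRing.Theory Num.Theory.
Import numFieldNormedType.Exports.

Local Open Scope classical_set_scope.
Local Open Scope ring_scope.

(** Write B for the closed unit ball of the dual of X and, for x in that dual,
    let f_x be the density with respect to mu of the real measure
    A |-> nu A x.  The map x |-> f_x is linear, and proving that every nu E
    comes from X amounts to a weak-star continuity property of this map on B.

    Fix E.  A functional on the dual which is small on the part of B that
    annihilates some finite set s of vectors of X is close in norm to the span
    of s, and X is norm closed in its bidual
    ([range_to_bidual_annihilator]).  If nu E is not in X there is
    therefore an e > 0 such that, for every finite s, the convex set C s of the
    x in B which vanish on s and satisfy nu E x >= e is nonempty.  These sets
    decrease as s grows.

    The plan is to find one function h that is almost everywhere the limit of
    densities of points of C s, for every s at once.  This is the role usually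
    played by weak compactness in L1; here strict convexity does it.  The
    integral of sqrt(1 + f_x^2) is bounded for x in B, so its infima over the
    sets C s have a finite supremum.  Two points of a C s with s large which
    nearly attain that supremum have densities that are uniformly close outside
    a set of small measure ([near_minimizers_almost_close]), because otherwise
    their midpoint, which lies in C s, would have a much smaller integral.

    So choose near-minimizers y_n in C s_n, along increasing s_n, whose
    densities are almost uniformly Cauchy.  By hypothesis some convex blocks of
    (y_n) converge weak-star to a functional z, and f_(y_n) converges to f_z
    almost uniformly ([almost_close_limit]).  Indeed, were the limit to differ
    from f_z, the difference would exceed some c > 0 on a set A of positive
    measure.  Any v in X taken from the weak-star closed convex hull of the
    average range of nu on A would then keep the blocks at distance at least c
    from z at v, against weak-star convergence ([weak_star_limit_le]).

    In particular nu E z >= e, so f_z >= c > 0 on some set P of positive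
    measure.  Let v in X be an average point of P, and repeat the construction
    with near-minimizers that vanish at v also.  It gives z' with z' v = 0
    and, the two sequences being near-minimizers of the same sets, with
    f_z' = f_z.  But f_z' >= c on P forces z' v >= c, a contradiction. *)

(** * The Hahn-Banach theorem through minimal sublinear functionals *)
Section sublinear.
Context {R : realType} (V : normedModType R).

(** Domination by the norm is part of the notion: it is what bounds the
    infimum of a chain from below and the final linear functional in norm. *)
Definition sublinear (p : V -> R) : Prop :=
  [/\ forall x, p x <= `|x|, forall x y, p (x + y) <= p x + p y &
      forall (t : R) x, 0 <= t -> p (t *: x) = t * p x].

Lemma sublinear_norm : sublinear (fun x => `|x|).
Proof.
split=> // [x y|t x t0]; first exact: ler_normD.
by rewrite normrZ ger0_norm.
Qed.

Lemma sublinear0 p : sublinear p -> p 0 = 0.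
Proof. by case=> _ _ pZ; rewrite -(scale0r 0) pZ// mul0r. Qed.

Lemma sublinear_ge p x : sublinear p -> - `|x| <= p x.
Proof.
move=> sp; have p0 := sublinear0 sp; case: sp => pn pD _.
by have := pD x (- x); rewrite subrr p0; have := pn (- x); rewrite normrN; lra.
Qed.

Lemma sublinear_homogeneous (p : V -> R) :
  p 0 = 0 -> (forall (t : R) x, 0 < t -> p (t *: x) <= t * p x) ->
  forall (t : R) x, 0 <= t -> p (t *: x) = t * p x.
Proof.
move=> p0 pZ t x; rewrite le_eqVlt => /predU1P[<-|t0].
  by rewrite scale0r p0 mul0r.
apply/eqP; rewrite eq_le pZ//= -ler_pdivlMl//.
have := pZ t^-1 (t *: x); rewrite invr_gt0 => /(_ t0).
by rewrite scalerA mulVf ?gt_eqF// scale1r.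
Qed.

(** The infimum over t >= 0 of p(x + t y) - t p(y) is the largest sublinear
    functional below p that takes the value - p(y) at - y, which is the value
    a linear functional agreeing with p at y has to take. *)
Definition tilt (p : V -> R) (y x : V) : R :=
  inf [set p (x + t *: y) - t * p y | t in [set t : R | 0 <= t]].

Lemma tilt_le p y x (t : R) : sublinear p -> 0 <= t ->
  tilt p y x <= p (x + t *: y) - t * p y.
Proof.
move=> sp t0; apply: ge_inf; last by exists t.
exists (- p (- x)) => _ [s /= s0 <-].
case: sp => _ pD pZ; rewrite -pZ//.
by have := pD (x + s *: y) (- x); rewrite addrAC subrr add0r; lra.
Qed.

Lemma tilt_sublinear p y : sublinear p -> sublinear (tilt p y).
Proof.
move=> sp; have [pn pD pZ] := sp.
have ne x : [set p (x + t *: y) - t * p y | t in [set t : R | 0 <= t]] !=set0.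
  by exists (p (x + 0 *: y) - 0 * p y); exists 0 => //=.
split.
- move=> x; apply: (le_trans (tilt_le _ _ sp (lexx 0))).
  by rewrite scale0r addr0 mul0r subr0.
- move=> x x'; rewrite -lerBlDr; apply: lb_le_inf => // _ [t /= t0 <-].
  rewrite lerBlDr -lerBlDl; apply: lb_le_inf => // _ [s /= s0 <-].
  rewrite lerBlDl; apply: (le_trans (tilt_le _ _ sp (addr_ge0 t0 s0))).
  have := pD (x + t *: y) (x' + s *: y).
  by rewrite addrACA -scalerDl; lra.
- apply: sublinear_homogeneous.
    apply/eqP; rewrite eq_le; apply/andP; split.
      apply: (le_trans (tilt_le _ _ sp (lexx 0))).
      by rewrite scale0r addr0 mul0r subr0 (sublinear0 sp).
    by apply: lb_le_inf => // _ [t /= t0 <-]; rewrite add0r pZ// subrr.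
  move=> t x t0; rewrite -ler_pdivrMl//.
  apply: lb_le_inf => // _ [s /= s0 <-]; rewrite ler_pdivrMl//.
  apply: (le_trans (tilt_le _ _ sp (mulr_ge0 (ltW t0) s0))).
  by rewrite -scalerA -scalerDr pZ ?(ltW t0)// mulrBr mulrA.
Qed.

Definition inf_sublinear (A : set (V -> R)) (x : V) : R :=
  inf [set p x | p in A].

Lemma inf_sublinear_le (A : set (V -> R)) p x : A `<=` sublinear -> A p ->
  inf_sublinear A x <= p x.
Proof.
move=> As Ap; apply: ge_inf; last by exists p.
by exists (- `|x|) => _ [q /= /As sq <-]; exact: sublinear_ge.
Qed.

Lemma inf_chain_sublinear (A : set (V -> R)) : A `<=` sublinear -> A !=set0 ->
  (forall p q, A p -> A q ->
    (forall x, p x <= q x) \/ (forall x, q x <= p x)) ->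
  sublinear (inf_sublinear A).
Proof.
move=> As [p0 Ap0] Atot.
have ne x : [set p x | p in A] !=set0 by exists (p0 x); exists p0.
split.
- by move=> x; apply: (le_trans (inf_sublinear_le x As Ap0)); case: (As _ Ap0).
- move=> x y; rewrite -lerBlDr; apply: lb_le_inf => // _ [p /= Ap <-].
  rewrite lerBlDr -lerBlDl; apply: lb_le_inf => // _ [q /= Aq <-].
  rewrite lerBlDl; have [_ pD _] := As _ Ap; have [_ qD _] := As _ Aq.
  have [pq|qp] := Atot _ _ Ap Aq.
    apply: (le_trans (inf_sublinear_le _ As Ap)).
    by have := pD x y; have := pq y; lra.
  apply: (le_trans (inf_sublinear_le _ As Aq)).
  by have := qD x y; have := qp x; lra.
- apply: sublinear_homogeneous.
    rewrite /inf_sublinear; have -> : [set p 0 | p in A] = [set 0 : R].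
      rewrite eqEsubset; split=> [_ [p /= /As/sublinear0 ? <-]//|_ ->].
      by exists p0; [|exact: (sublinear0 (As _ Ap0))].
    by rewrite inf1.
  move=> t x t0; rewrite -ler_pdivrMl//; apply: lb_le_inf => // _ [p /= Ap <-].
  rewrite ler_pdivrMl//; apply: (le_trans (inf_sublinear_le _ As Ap)).
  by have [_ _ pZ] := As _ Ap; rewrite pZ// ltW.
Qed.

(** Zorn's lemma for the reversed pointwise order: the pointwise infimum of a
    chain of sublinear functionals is again sublinear. *)
Lemma exists_minimal_sublinear q : sublinear q ->
  exists p, [/\ sublinear p, forall x, p x <= q x &
    forall p', sublinear p' -> (forall x, p' x <= p x) -> p' = p].
Proof.
move=> sq.
pose T := {p : V -> R | sublinear p /\ forall x, p x <= q x}.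
pose leT (s t : T) := `[< forall x, projT1 t x <= projT1 s x >].
have [||||[p [sp pq]] pmax] := @Zorn T leT.
- by move=> t; apply/asboolP.
- move=> r s t /asboolP rs /asboolP st; apply/asboolP => x.
  exact: le_trans (st x) (rs x).
- move=> [s hs] [t ht] /asboolP/= st /asboolP/= ts; apply: eq_exist.
  by apply/funext => x; apply/eqP; rewrite eq_le st ts.
- move=> A Atot; have [[[p0 hp0] Ap0]|A0] := pselect (A !=set0); last first.
    exists (exist _ q (conj sq (fun=> lexx _))) => s As.
    by exfalso; apply: A0; exists s.
  pose B := [set projT1 s | s in A].
  have Bs : B `<=` sublinear by move=> _ [[p hp] _ <-] /=; case: hp.
  have Bp0 : B p0 by exists (exist _ p0 hp0).
  have sB : sublinear (inf_sublinear B).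
    apply: inf_chain_sublinear => //; first by exists p0.
    move=> _ _ [s As <-] [t At <-].
    by have [/asboolP|/asboolP] := Atot _ _ As At; [right|left].
  have Bq x : inf_sublinear B x <= q x.
    exact: le_trans (inf_sublinear_le x Bs Bp0) (hp0.2 x).
  pose b : T := exist (fun p : V -> R => sublinear p /\ forall x, p x <= q x)
    _ (conj sB Bq).
  exists b => s As; apply/asboolP => x /=.
  by apply: inf_sublinear_le => //; exists s.
exists p; split=> // p' sp' p'p.
have h : sublinear p' /\ forall x, p' x <= q x.
  by split=> // x; exact: le_trans (p'p x) (pq x).
by have [] := pmax (exist _ p' h) (asboolT p'p).
Qed.

(** Tilting p at y gives a sublinear functional below p, hence p itself by
    minimality; so p(- y) = - p(y), and subadditivity becomes additivity. *)
Lemma minimal_sublinear_linear p : sublinear p ->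
  (forall p', sublinear p' -> (forall x, p' x <= p x) -> p' = p) ->
  linear (p : V -> R^o).
Proof.
move=> sp pmin; have [pn pD pZ] := sp.
have pN y : p (- y) = - p y.
  have tp : tilt p y = p.
    apply: pmin; first exact: tilt_sublinear.
    move=> x; apply: (le_trans (tilt_le _ _ sp (lexx 0))).
    by rewrite scale0r addr0 mul0r subr0.
  have := tilt_le y (- y) sp ler01.
  rewrite tp scale1r addNr mul1r (sublinear0 sp) sub0r => h.
  by have := pD y (- y); rewrite subrr (sublinear0 sp); lra.
have pDE x y : p (x + y) = p x + p y.
  apply/eqP; rewrite eq_le pD/=.
  by have := pD (x + y) (- y); rewrite addrK pN; lra.
move=> t x y; rewrite pDE; congr (_ + _).
have [t0|t0] := leP 0 t; first by rewrite pZ.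
rewrite -[LHS]opprK -pN -scaleNr pZ ?oppr_ge0 ?ltW//.
by rewrite /GRing.scale/= mulNr opprK.
Qed.

(** A minimal sublinear functional below the norm tilted at v is linear and is
    at most - |v| at - v. *)
Lemma exists_norming_functional (v : V) :
  exists f : dual V, `|f| <= 1 /\ f v = `|v|.
Proof.
have sn := sublinear_norm.
have [p [sp pq pmin]] := exists_minimal_sublinear (tilt_sublinear v sn).
have pl := minimal_sublinear_linear sp pmin.
have [pn _ _] := sp.
have pnx x : `|p x| <= `|x| by rewrite ler_norml pn sublinear_ge.
pose p' : V -> R^o := p.
pose L := GRing.isLinear.Build R V R^o *:%R p' pl.
pose pL : {linear V -> R^o} := HB.pack p' L.
have pP : p' \in @dual_pred R V.
  apply/asboolP; split=> //.
  apply: (@bounded_linear_continuous _ _ _ pL); apply/linear_boundedP.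
  exists 1; split=> [|r /ltW r1 x]; first exact: ger0_real.
  by apply: (le_trans (pnx x)); rewrite ler_peMl.
exists (Dual pP); split.
  by apply: dual_norm_le => x x1; apply: le_trans (pnx x) _.
apply/eqP; rewrite eq_le; apply/andP; split; first exact: pn.
have := le_trans (pq (- v)) (tilt_le v (- v) sn ler01).
rewrite scale1r addNr normr0 mul1r sub0r.
have -> : p (- v) = - p v := raddfN pL v.
by rewrite lerN2.
Qed.

End sublinear.

(** * Elements of the bidual that come from the space *)
Section finite_annihilator.
Context {R : realType} (V : normedModType R).
Implicit Types (phi : dual (dual V)) (f : dual V).

Lemma dualBE (W : normedModType R) (f g : dual W) x : (f - g) x = f x - g x.
Proof. by []. Qed.
Lemma dualDE (W : normedModType R) (f g : dual W) x : (f + g) x = f x + g x.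
Proof. by []. Qed.
Lemma dualZE (W : normedModType R) a (f : dual W) x : (a *: f) x = a * f x.
Proof. by []. Qed.

(** Each vector u of the list is removed by one step of Hahn-Banach extension.
    Subtracting t u from phi keeps the bound on the annihilator of the other
    vectors as soon as phi f - e |f| <= t <= phi f + e |f| for every f in it
    with f u = 1.  Such a t exists because phi (f - g) <= e |f - g| whenever
    f and g are two such functionals. *)
Lemma annihilator_approx (s : seq V) (e : R) : 0 <= e ->
  forall phi, (forall f, (forall v, v \in s -> f v = 0) -> phi f <= e * `|f|) ->
  exists v, forall f, phi f - f v <= e * `|f|.
Proof.
move=> e0; elim: s => [|u s IH] phi hphi.
  by exists 0 => f; rewrite linear0 subr0; exact: hphi.
pose ann f := forall v, v \in s -> f v = 0.
pose S := [set phi f - e * `|f| | f in [set f | ann f /\ f u = 1]].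
have Sub f g : ann f -> ann g -> f u = 1 -> g u = 1 ->
    phi f - e * `|f| <= phi g + e * `|g|.
  move=> af ag fu gu; rewrite lerBlDr -addrA -lerBlDl -mulrDr -linearB.
  apply: (le_trans (hphi (f - g) _)).
    move=> v; rewrite inE dualBE => /predU1P[->|vs].
      by rewrite fu gu subrr.
    by rewrite af// ag// subrr.
  by rewrite ler_wpM2l// [leRHS]addrC; exact: (ler_normB f g).
pose t := sup S.
have lo f : ann f -> f u = 1 -> phi f - e * `|f| <= t.
  move=> af fu; apply: ub_le_sup; last by exists f.
  by exists (phi f + e * `|f|) => _ [g [ag gu] <-]; exact: Sub.
have hi f : ann f -> f u = 1 -> t <= phi f + e * `|f|.
  move=> af fu; apply: ge_sup; first by exists (phi f - e * `|f|); exists f.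
  by move=> _ [g [ag gu] <-]; exact: Sub.
have [f af|v hv] := IH (phi - t *: to_bidual u).
  rewrite dualBE dualZE.
  change (phi f - t * f u <= e * `|f|).
  have [fu0|fu0] := eqVneq (f u) 0.
    rewrite fu0 mulr0 subr0; apply: hphi => v; rewrite inE.
    by move=> /predU1P[->//|]; exact: af.
  have ag : ann ((f u)^-1 *: f).
    by move=> v vs; rewrite dualZE (af _ vs) mulr0.
  have gu : ((f u)^-1 *: f) u = 1 by rewrite dualZE mulVf.
  have := lo _ ag gu; have := hi _ ag gu.
  rewrite !linearZ/= normrZ normfV; set n := `|f|; set p := phi f.
  rewrite /GRing.scale/= => h1 h2.
  have [fp|fn] := ltP 0 (f u).
    have := ler_wpM2l (ltW fp) h2; rewrite gtr0_norm//.
    have -> : f u * ((f u)^-1 * p + e * - ((f u)^-1 * n)) = p - e * n by field.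
    by lra.
  have fn' : f u < 0 by rewrite lt_neqAle fu0.
  have := ler_wnM2l (ltW fn') h1; rewrite ltr0_norm//.
  have -> : f u * ((f u)^-1 * p + e * ((- f u)^-1 * n)) = p - e * n.
    by rewrite invrN; field.
  by lra.
exists (v + t *: u) => f; have := hv f.
have -> : (phi - t *: to_bidual u) f = phi f - t * f u by [].
have -> : f (v + t *: u) = f v + t * f u by rewrite linearD linearZ.
by rewrite opprD addrA addrAC.
Qed.

End finite_annihilator.

Section range_to_bidual.
Context {R : realType}.

Lemma normr_to_bidual (V : normedModType R) (v : V) : `|to_bidual v| = `|v|.
Proof.
apply/eqP; rewrite eq_le; apply/andP; split.
  apply: dual_norm_le => f f1; apply: (le_trans (le_dual_norm f v)).
  by rewrite ler_piMl.
have [f [f1 fv]] := exists_norming_functional v.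
have : `|f v| <= `|to_bidual v| * `|f| := le_dual_norm (to_bidual v) f.
by rewrite fv normr_id => /le_trans; apply; rewrite ler_piMr.
Qed.

Lemma to_bidualB (V : normedModType R) (u v : V) :
  to_bidual (u - v) = to_bidual u - to_bidual v.
Proof.
apply: dual_eqP => f; rewrite dualBE; change (f (u - v) = f u - f v).
by rewrite linearB.
Qed.

(** The canonical embedding is isometric, so the range inherits the
    completeness of X. *)
Lemma range_to_bidual_closed (X : completeNormedModType R)
    (phi : dual (dual X)) :
  (forall e : R, 0 < e -> exists v : X, `|phi - to_bidual v| <= e) ->
  range (@to_bidual R X) phi.
Proof.
move=> hphi.
have hn n : {v : X | `|phi - to_bidual v| <= 2^-1 ^+ n}.
  by apply: cid; apply: hphi; rewrite exprn_gt0.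
pose v n : X := projT1 (hn n).
have hv n : `|phi - to_bidual (v n)| <= 2^-1 ^+ n := projT2 (hn n).
have e0 (e : R) : 0 < e -> exists N, forall n, (N <= n)%N -> 2^-1 ^+ n < e.
  move=> e0.
  have /cvgrPdist_lt/(_ e e0)[N _ hN] : (2^-1 ^+ n : R) @[n --> \oo] --> 0.
    by apply: cvg_expr; rewrite ger0_norm// invf_lt1 ?ltr1n.
  exists N => n Nn; have := hN n Nn.
  by rewrite sub0r normrN ger0_norm// exprn_ge0.
have cv : cvgn v.
  apply/cauchy_cvgP/cauchy_exP => e e0'.
  have [|N hN] := e0 (e / 2); first by rewrite divr_gt0.
  exists (v N); exists N => // n /= Nn.
  rewrite -ball_normE /ball_/= -normr_to_bidual to_bidualB.
  have -> : to_bidual (v N) - to_bidual (v n) =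
     (phi - to_bidual (v n)) - (phi - to_bidual (v N)).
    by rewrite opprB [RHS]addrC addrA subrK.
  apply: (le_lt_trans (ler_normB _ _)).
  by have := hv n; have := hv N; have := hN _ Nn; have := hN _ (leqnn N); lra.
exists (limn v) => //; apply/eqP; rewrite eq_sym -subr_eq0 -normr_le0.
apply/ler_addgt0Pl => e e0'; rewrite addr0.
have [|N hN] := e0 (e / 2); first by rewrite divr_gt0.
have /cvgrPdist_lt/(_ (e / 2))[|M _ hM] := cv; first by rewrite divr_gt0.
pose n := maxn N M.
have -> : phi - to_bidual (limn v) =
    (phi - to_bidual (v n)) - to_bidual (limn v - v n).
  by rewrite to_bidualB opprB addrA subrK.
apply: (le_trans (ler_normB _ _)); rewrite normr_to_bidual.
have := hM n (leq_maxr _ _); have := hN n (leq_maxl _ _); have := hv n => /=.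
by lra.
Qed.

(** This criterion is how an element of the bidual is recognized as a vector of
    X below: weak-star continuity at 0 on the unit ball, tested only on the
    annihilators of finite sets. *)
Lemma range_to_bidual_annihilator (X : completeNormedModType R)
    (phi : dual (dual X)) :
  (forall e : R, 0 < e -> exists s : seq X, forall f : dual X,
    `|f| <= 1 -> (forall v, v \in s -> f v = 0) -> phi f <= e) ->
  range (@to_bidual R X) phi.
Proof.
move=> hphi; apply: range_to_bidual_closed => e e0; have [s hs] := hphi e e0.
have [f sf|v hv] := annihilator_approx (s := s) (ltW e0) (phi := phi).
  have [f0|f0] := eqVneq `|f| 0.
    by rewrite (normr0_eq0 f0) linear0 normr0 mulr0.
  have fp : 0 < `|f| by rewrite lt_neqAle eq_sym f0 /=.
  have := hs (`|f|^-1 *: f).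
  rewrite normrZ normfV normr_id mulVf// => /(_ (lexx _)).
  rewrite linearZ/= /GRing.scale/= ler_pdivrMl// mulrC; apply => v /sf.
  by move=> fv0; rewrite fv0 scaler0.
exists v; apply: dual_norm_le => f f1.
have h g : `|g| <= 1 -> (phi - to_bidual v) g <= e.
  move=> g1; apply: (le_trans (hv g)).
  by rewrite ler_piMr// ltW.
rewrite ler_norml h// andbT lerNl -linearN.
by apply: h; rewrite normrN.
Qed.

End range_to_bidual.

(** * Vector measures with values in a dual space *)
Section dual_valued_measure.
Context {d : measure_display} {T : measurableType d} {R : realType}.
Context {W : normedModType R}.
Variables (mu : {finite_measure set T -> \bar R}) (nu : set T -> dual W).
Hypothesis nuD : countably_additive nu.
Hypothesis numu : measure_continuous mu nu.

Local Notation mass A := (fine (mu A)).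

Lemma le_mass A B : measurable A -> measurable B -> A `<=` B ->
  mass A <= mass B.
Proof.
move=> mA mB AB; rewrite fine_le ?fin_num_measure//.
by apply: le_measure; rewrite ?inE.
Qed.

Lemma massU_le A B : measurable A -> measurable B ->
  mass (A `|` B) <= mass A + mass B.
Proof.
move=> mA mB; rewrite -fineD ?fin_num_measure//.
apply: fine_le; rewrite ?fin_numD ?fin_num_measure//; first exact: measurableU.
by apply: measureU2.
Qed.

Lemma vector_measure0 : nu set0 = 0.
Proof.
have h : series (nu \o fun=> set0) @ \oo --> nu (\bigcup_(_ : nat) set0).
  by apply: nuD => //; exact: trivIset_set0.
have /(cvg_lim (@norm_hausdorff _ _)) := cvg_series_cvg_0 (cvgP _ h).
by rewrite lim_cst//; exact: norm_hausdorff.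
Qed.

Lemma vector_measureU A B : measurable A -> measurable B -> A `&` B = set0 ->
  nu (A `|` B) = nu A + nu B.
Proof.
move=> mA mB AB0; have mAB n : measurable (bigcup2 A B n).
  by rewrite /bigcup2; case: ifP => // _; case: ifP.
have := nuD mAB; rewrite -trivIset_bigcup2 bigcup2E => /(_ AB0) h.
apply: (@cvg_unique _ _ _ _ _ _ h) => //.
apply: cvg_near_cst; exists 2%N => // n /= n2; apply/eqP.
rewrite /series/= -(subnKC n2) /index_iota subn0 iotaD big_cat/=.
rewrite !big_cons big_nil addr0/= big_seq big1 ?addr0// => i.
rewrite mem_iota => /andP[]; case: i => [//|[//|i _ _]].
exact: vector_measure0.
Qed.

Lemma vector_measureID A B : measurable A -> measurable B ->
  nu A = nu (A `&` B) + nu (A `\` B).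
Proof.
move=> mA mB; rewrite -vector_measureU.
- by rewrite setUIDK.
- exact: measurableI.
- exact: measurableD.
- by rewrite setIACA setICr setI0.
Qed.

Lemma vector_measure_null A : measurable A -> mass A = 0 -> nu A = 0.
Proof.
move=> mA A0; apply/eqP; rewrite -normr_le0; apply/ler_addgt0Pl => e e0.
rewrite addr0; have [r r0] := numu e0; move=> /(_ A mA) h; apply/ltW/h.
by rewrite -(@fineK _ (mu A)) ?fin_num_measure// A0 lte_fin.
Qed.

Let bounded_on A := exists M, forall B, measurable B -> B `<=` A ->
  `|nu B| <= M.

Let bounded_onU A B : measurable B ->
  bounded_on (A `&` B) -> bounded_on (A `\` B) -> bounded_on A.
Proof.
move=> mB [M hM] [N hN]; exists (M + N) => C mC CA.
rewrite (vector_measureID mC mB); apply: (le_trans (ler_normD _ _)).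
apply: lerD; [apply: hM|apply: hN].
- exact: measurableI.
- by move=> x [/CA].
- exact: measurableD.
- by move=> x [/CA].
Qed.

(** If nu is unbounded on the subsets of A, some B included in A has |nu B|
    larger than |nu A| + 1, so that both B and its complement in A carry norm
    at least 1, and nu is still unbounded on one of the two.  Iterating cuts off
    disjoint sets of norm at least 1, against countable additivity. *)
Lemma vector_measure_bounded : exists M : R, forall A, measurable A ->
  `|nu A| <= M.
Proof.
apply: contrapT => nb.
have bT : ~ bounded_on setT.
  by move=> [M hM]; apply: nb; exists M => A mA; exact: hM.
pose bad A := measurable A /\ ~ bounded_on A.
have step A : bad A -> exists B, [/\ bad B, B `<=` A & 1 <= `|nu (A `\` B)|].
  move=> [mA bA].
  have [B [mB BA nB]] : exists B, [/\ measurable B, B `<=` A &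
      `|nu A| + 1 < `|nu B|].
    apply: contrapT => h; apply: bA; exists (`|nu A| + 1) => B mB BA.
    by rewrite leNgt; apply/negP => lB; apply: h; exists B.
  have nD : 1 <= `|nu (A `\` B)|.
    have -> : nu (A `\` B) = nu A - nu B.
      by rewrite (vector_measureID mA mB) (setIidr BA) addrC addKr.
    by have := lerB_dist (nu B) (nu A); rewrite distrC; lra.
  have [bB|bB] := pselect (bounded_on B); last by exists B.
  exists (A `\` B); split.
  - split; first exact: measurableD.
    move=> bD; apply: bA; apply: (bounded_onU mB) => //.
    by rewrite (setIidr BA).
  - by move=> x [].
  - by rewrite setDD (setIidr BA); have := normr_ge0 (nu A); lra.
pose S := {A | bad A}.
have nxt (s : S) : {t : S | projT1 t `<=` projT1 s /\
    1 <= `|nu (projT1 s `\` projT1 t)|}.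
  apply: cid; have [B [bB BA nB]] := step _ (projT2 s).
  by exists (exist _ B bB).
pose s0 : S := exist bad setT (conj measurableT bT).
pose A := fix A n := if n is m.+1 then projT1 (nxt (A m)) else s0.
have mA n : measurable (projT1 (A n)) by have [] := projT2 (A n).
pose D n := projT1 (A n) `\` projT1 (A n.+1).
have Asub m n : (m <= n)%N -> projT1 (A n) `<=` projT1 (A m).
  move=> /subnK <-; elim: (n - m)%N => [//|k IH].
  by apply: (subset_trans _ IH); have [] := projT2 (nxt (A (k + m)%N)).
have tD : trivIset setT D.
  apply/trivIsetP => i j _ _; wlog ij : i j / (i < j)%N.
    move=> h; rewrite neq_ltn => /orP[ij|ji]; last rewrite setIC;
      by apply: h => //; rewrite neq_ltn ?ij ?ji.
  move=> _; rewrite -subset0 => x [[_ nx] [xj _]]; apply: nx.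
  exact: Asub xj.
have mD n : measurable (D n) := measurableD (mA n) (mA n.+1).
have /(cvgP _)/cvg_series_cvg_0 := nuD mD tD.
move=> /cvgr0Pnorm_lt/(_ _ ltr01)[N _ /(_ N (leqnn N))] /=.
by have [_] := projT2 (nxt (A N)); rewrite leNgt => /negP.
Qed.

Section density.
Variable x : W.

Let scalar (A : set T) : \bar R := (nu A x)%:E.

Let scalar0 : scalar set0 = 0%E.
Proof. by rewrite /scalar vector_measure0. Qed.

Let scalar_fin A : measurable A -> scalar A \is a fin_num.
Proof. by []. Qed.

Let scalar_sigma_additive : semi_sigma_additive scalar.
Proof.
move=> F mF tF _.
have h : (series (nu \o F) n x) @[n --> \oo] --> (nu (\bigcup_n F n) x : R^o).
  apply: (@cvg_comp _ _ _ (series (nu \o F)) (dual_eval x) _ _ _ (nuD mF tF)).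
  have /asboolP[_] := dual_evalP x; exact.
have -> : (fun n => \sum_(0 <= i < n) scalar (F i))%E =
    (fun n => ((series (nu \o F) n x)%:E))%E.
  apply/funext => n; rewrite /scalar sumEFin; congr EFin.
  exact/esym/(big_morph (fun f : dual W => f x)).
by apply: cvg_EFin => //; exact: nearW.
Qed.

HB.instance Definition _ := isCharge.Build d T R scalar scalar0 scalar_fin
  scalar_sigma_additive.

(** Radon-Nikodym for the real measure A |-> nu A x. *)
Lemma exists_density : exists f : T -> R,
  mu.-integrable setT (EFin \o f) /\
  forall A, measurable A -> nu A x = \int[mu]_(w in A) f w.
Proof.
have dom : scalar `<< mu.
  apply/null_content_dominatesP => A mA A0.
  by rewrite /scalar vector_measure_null// A0.
pose g := Radon_Nikodym [the charge _ _ of scalar] mu.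
have gE : EFin \o (fine \o g) = g.
  by apply/funext => w /=; rewrite fineK// Radon_Nikodym_fin_num.
exists (fine \o g); split; first by rewrite gE; exact: Radon_Nikodym_integrable.
move=> A mA; rewrite /Rintegral -[LHS]/(fine (scalar A)).
by rewrite (Radon_Nikodym_integral dom mA) -[in LHS]/g -{1}gE.
Qed.

End density.

Definition density x : T -> R := projT1 (cid (exists_density x)).

Lemma integrable_density x : mu.-integrable setT (EFin \o density x).
Proof. exact: (projT2 (cid (exists_density x))).1. Qed.

Lemma integral_density x A : measurable A ->
  nu A x = \int[mu]_(w in A) density x w.
Proof. exact: (projT2 (cid (exists_density x))).2. Qed.

Lemma measurable_density x : measurable_fun setT (density x).
Proof. exact/measurable_EFinP/measurable_int/integrable_density. Qed.

End dual_valued_measure.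

(** * Strict convexity of t |-> sqrt(1 + t^2) *)
Section hypotenuse.
Context {R : realType}.
Implicit Types s t K e : R.

(** A strictly convex function of linear growth: the growth keeps its integral
    finite along the densities, which are merely integrable, and the strict
    convexity makes near-minimizers cluster. *)
Definition hypot t : R := Num.sqrt (1 + t ^+ 2).

Lemma sqr_hypot t : hypot t ^+ 2 = 1 + t ^+ 2.
Proof. by rewrite sqr_sqrtr// addr_ge0// sqr_ge0. Qed.

Lemma hypot_ge1 t : 1 <= hypot t.
Proof. by rewrite -[leLHS]sqrtr1 ler_wsqrtr// lerDl sqr_ge0. Qed.

Lemma hypot_le t : hypot t <= 1 + `|t|.
Proof.
rewrite -(@ler_pXn2r _ 2)// ?nnegrE ?addr_ge0//; last exact: sqrtr_ge0.
rewrite sqr_hypot sqrrD expr1n mul1r real_normK ?num_real//.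
by have := normr_ge0 t; lra.
Qed.

(** With a, b, m the values at s, t and at their midpoint and N = a b, one has
    (a + b - 2 m) (a + b + 2 m) = 2 (N - (1 + s t)) and
    (N - (1 + s t)) (N + (1 + s t)) = (s - t)^2, while 2 m <= a + b and
    1 + s t <= N. *)
Lemma hypot_midpoint_convex s t :
  (s - t) ^+ 2 <= (hypot s + hypot t - 2 * hypot ((s + t) / 2)) *
    (2 * (hypot s * hypot t) * (hypot s + hypot t)).
Proof.
have := hypot_ge1 s; have := hypot_ge1 t; have := hypot_ge1 ((s + t) / 2).
have := sqr_hypot s; have := sqr_hypot t; have := sqr_hypot ((s + t) / 2).
move: (hypot s) (hypot t) (hypot _) => a b m hm ht hs m1 b1 a1.
pose N := a * b.
have N0 : 0 <= N by rewrite mulr_ge0//; lra.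
have NE : (N - (1 + s * t)) * (N + (1 + s * t)) = (s - t) ^+ 2.
  by rewrite -subr_sqr /N exprMn hs ht; ring.
have Nst : 1 + s * t <= N.
  have [h|h] := leP (1 + s * t) 0; first exact: le_trans h N0.
  rewrite -(@ler_pXn2r _ 2)// ?nnegrE ?(ltW h)// -subr_ge0 subr_sqr NE.
  exact: sqr_ge0.
have Nst' : - (1 + s * t) <= N.
  have [h|h] := leP 0 (1 + s * t).
    by apply: le_trans N0; rewrite oppr_le0.
  rewrite -(@ler_pXn2r _ 2)// ?nnegrE ?oppr_ge0 ?(ltW h)//.
  by rewrite sqrrN -subr_ge0 subr_sqr NE sqr_ge0.
have DE : (a + b - 2 * m) * (a + b + 2 * m) = 2 * (N - (1 + s * t)).
  rewrite -subr_sqr exprMn hm sqrrD hs ht /N.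
  by field.
have D0 : 0 <= a + b - 2 * m.
  rewrite -(@pmulr_lge0 _ (a + b + 2 * m)); last by lra.
  by rewrite DE mulr_ge0// subr_ge0.
have h1 : N - (1 + s * t) <= (a + b - 2 * m) * (a + b).
  by move: DE; nra.
rewrite -NE -/N.
have : (N - (1 + s * t)) * (N + (1 + s * t)) <= (N - (1 + s * t)) * (2 * N).
  by apply: ler_wpM2l; lra.
move/le_trans; apply.
have -> : (a + b - 2 * m) * (2 * N * (a + b)) =
   ((a + b - 2 * m) * (a + b)) * (2 * N) by ring.
by apply: ler_wpM2r => //; rewrite mulr_ge0.
Qed.

Lemma hypot_midpoint_le s t : 2 * hypot ((s + t) / 2) <= hypot s + hypot t.
Proof.
rewrite -subr_ge0.
have := hypot_ge1 s; have := hypot_ge1 t => h1 h2.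
have h : 0 < 2 * (hypot s * hypot t) * (hypot s + hypot t).
  by rewrite !mulr_gt0//; lra.
rewrite -(pmulr_lge0 _ h).
by apply: le_trans (hypot_midpoint_convex s t); exact: sqr_ge0.
Qed.

(** On [-K, K] the two values are at most 1 + K, which bounds the second factor
    in [hypot_midpoint_convex] by 4 (1 + K)^3. *)
Lemma hypot_midpoint_gap K e s t : 0 < e -> `|s| <= K -> `|t| <= K ->
  e <= `|s - t| ->
  e ^+ 2 / (4 * (1 + K) ^+ 3) <= hypot s + hypot t - 2 * hypot ((s + t) / 2).
Proof.
move=> e0 sK tK est; have K0 : 0 <= K by exact: le_trans sK.
rewrite ler_pdivrMr; last by rewrite mulr_gt0// exprn_gt0//; lra.
apply: (@le_trans _ _ ((s - t) ^+ 2)).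
  rewrite -[leRHS]real_normK ?num_real//.
  by rewrite ler_pXn2r// ?nnegrE// ltW.
apply: (le_trans (hypot_midpoint_convex s t)); apply: ler_wpM2l.
  by rewrite subr_ge0 hypot_midpoint_le.
have := hypot_ge1 s; have := hypot_ge1 t.
have := hypot_le s; have := hypot_le t.
move: (hypot s) (hypot t) => a b bt as_ b1 a1.
have aL : a <= 1 + K by lra.
have bL : b <= 1 + K by lra.
have ab : a * b <= (1 + K) * (1 + K) by apply: ler_pM; lra.
have : a * b * (a + b) <= (1 + K) * (1 + K) * (2 * (1 + K)).
  by apply: ler_pM => //; [nra|lra|lra].
by rewrite !exprS expr0; lra.
Qed.

End hypotenuse.

(** * The area functional and its near-minimizers *)
Section graph_area.
Context {d : measure_display} {T : measurableType d} {R : realType}.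
Variable mu : {finite_measure set T -> \bar R}.
Implicit Types f g : T -> R.

Local Notation mass A := (fine (mu A)).
Local Notation integrable f := (mu.-integrable setT (EFin \o f)).

Definition graph_area f : R := \int[mu]_w hypot (f w).

Lemma measurable_integrable f : integrable f -> measurable_fun setT f.
Proof. by move=> /measurable_int/measurable_EFinP. Qed.

Lemma measurable_hypot f : measurable_fun setT f ->
  measurable_fun setT (fun w => hypot (f w)).
Proof.
move=> mf; apply: (measurableT_comp (f := @Num.sqrt R)).
  by apply: continuous_measurable_fun; exact: sqrt_continuous.
by apply: measurable_funD => //; exact: measurable_funX.
Qed.

Lemma integrable_add f g : integrable f -> integrable g ->
  integrable (fun w => f w + g w).
Proof. by move=> intf intg; exact: (integrableD _ intf intg). Qed.

Lemma integrable_hypot f : integrable f -> integrable (fun w => hypot (f w)).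
Proof.
move=> intf.
have intg : integrable (fun w => 1 + `|f w|).
  apply: (@integrable_add (cst 1)); last exact: integrable_norm.
  exact: finite_measure_integrable_cst.
apply: le_integrable intg => //.
  exact/measurable_EFinP/measurable_hypot/measurable_integrable.
move=> w _ /=; rewrite !lee_fin ger0_norm ?sqrtr_ge0//.
by rewrite ger0_norm ?hypot_le// addr_ge0.
Qed.

Lemma measurable_le_set f g : measurable_fun setT f -> measurable_fun setT g ->
  measurable [set w | f w <= g w].
Proof.
by move=> mf mg; have := measurable_fun_le measurableT mf mg; rewrite setTI.
Qed.

Lemma measurable_norm f : measurable_fun setT f ->
  measurable_fun setT (fun w => `|f w|).
Proof. by move=> mf; exact: measurableT_comp. Qed.

Definition gap_set f g (K e : R) : set T :=
  [set w | [/\ `|f w| <= K, `|g w| <= K & e <= `|f w - g w| ] ].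

Lemma measurable_gap_set f g (K e : R) :
  measurable_fun setT f -> measurable_fun setT g ->
  measurable (gap_set f g K e).
Proof.
move=> mf mg.
have -> : gap_set f g K e = [set w | `|f w| <= K] `&` [set w | `|g w| <= K] `&`
    [set w | e <= `|f w - g w|].
  by apply/seteqP; split=> w /= => [[]//|[[]]].
apply: measurableI; first apply: measurableI.
- by apply: measurable_le_set; [exact: measurable_norm|exact: measurable_cst].
- by apply: measurable_le_set; [exact: measurable_norm|exact: measurable_cst].
- apply: measurable_le_set; first exact: measurable_cst.
  exact/measurable_norm/measurable_funB.
Qed.

Lemma integrable_restr f A : measurable A -> integrable f ->
  mu.-integrable A (EFin \o f).
Proof. by move=> mA; exact: integrableS. Qed.

Lemma integrable_scale (c : R) f : integrable f ->
  integrable (fun w => c * f w).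
Proof. by move=> intf; exact: (integrableZl _ c intf). Qed.

Lemma le_integral_mass A c f : measurable A -> integrable f ->
  (forall w, A w -> c <= f w) -> c * mass A <= \int[mu]_(w in A) f w.
Proof.
move=> mA intf cf; rewrite -Rintegral_cst//; apply: le_Rintegral => //.
  exact: finite_measure_integrable_cst.
exact: integrable_restr.
Qed.

Lemma ge_integral_mass A c f : measurable A -> integrable f ->
  (forall w, A w -> f w <= c) -> \int[mu]_(w in A) f w <= c * mass A.
Proof.
move=> mA intf cf; rewrite -Rintegral_cst//; apply: le_Rintegral => //.
  exact: integrable_restr.
exact: finite_measure_integrable_cst.
Qed.

Lemma integral_setID A f : measurable A -> integrable f ->
  \int[mu]_w f w = \int[mu]_(w in A) f w + \int[mu]_(w in ~` A) f w.
Proof.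
move=> mA intf; rewrite -Rintegral_setU ?setUv//; first exact: measurableC.
by apply/disj_setPS; rewrite setICr.
Qed.

Lemma ge0_integral_mass A c f : measurable A -> integrable f ->
  (forall w, 0 <= f w) -> (forall w, A w -> c <= f w) ->
  c * mass A <= \int[mu]_w f w.
Proof.
move=> mA intf f0 cf; rewrite (integral_setID mA)//.
apply: (le_trans (le_integral_mass mA intf cf)).
by rewrite lerDl Rintegral_ge0.
Qed.

Lemma graph_area_ae f g : integrable f -> integrable g ->
  (forall A, measurable A -> \int[mu]_(w in A) f w = \int[mu]_(w in A) g w) ->
  graph_area f = graph_area g.
Proof.
move=> intf intg fg.
have fg_ae : ae_eq mu setT (EFin \o f) (EFin \o g).
  apply: integral_ae_eq => //; first exact: measurable_int intg.
  move=> A _ mA; have := fg A mA; rewrite /Rintegral => h.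
  rewrite -[LHS]fineK ?(integrable_fin_num _ (integrable_restr _ _))//.
  by rewrite -[RHS]fineK ?(integrable_fin_num _ (integrable_restr _ _))// h.
rewrite /graph_area /Rintegral; congr fine; apply: ae_eq_integral => //.
- exact/measurable_EFinP/measurable_hypot/measurable_integrable.
- exact/measurable_EFinP/measurable_hypot/measurable_integrable.
- exact: (ae_eq_comp (fun r => (hypot (fine r))%:E)) fg_ae.
Qed.

(** The midpoint defect of [hypot] is nonnegative everywhere and bounded below
    on the gap set, so its integral controls the measure of that set. *)
Lemma graph_area_gap f g (K e : R) : 0 < e -> 0 <= K ->
    integrable f -> integrable g ->
  e ^+ 2 / (4 * (1 + K) ^+ 3) *
    mass (gap_set f g K e) <=
  graph_area f + graph_area g - 2 * graph_area (fun w => (f w + g w) / 2).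
Proof.
move=> e0 K0 intf intg.
have intm : integrable (fun w => (f w + g w) / 2).
  have -> : (fun w => (f w + g w) / 2) = (fun w => 2^-1 * (f w + g w)).
    by apply/funext => w; rewrite mulrC.
  by apply: integrable_scale; exact: integrable_add.
have mE : measurable (gap_set f g K e).
  by apply: measurable_gap_set; exact: measurable_integrable.
have i1 : integrable (fun w => hypot (f w) + hypot (g w)).
  by apply: integrable_add; exact: integrable_hypot.
have i2 : integrable (fun w => (- 2) * hypot ((f w + g w) / 2)).
  by apply: integrable_scale; exact: integrable_hypot.
have -> : graph_area f + graph_area g -
      2 * graph_area (fun w => (f w + g w) / 2) =
    \int[mu]_w (hypot (f w) + hypot (g w) + (- 2) * hypot ((f w + g w) / 2)).
  rewrite RintegralD// RintegralD//; try exact: integrable_hypot.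
  by rewrite RintegralZl ?mulNr//; exact: integrable_hypot.
apply: ge0_integral_mass => //.
- exact: integrable_add i1 i2.
- by move=> w; rewrite mulNr subr_ge0 hypot_midpoint_le.
- by move=> w [fK gK efg]; rewrite mulNr; exact: hypot_midpoint_gap.
Qed.

End graph_area.

Section near_minimizers.
Context {d : measure_display} {T : measurableType d} {R : realType}.
Context {W : normedModType R}.
Variables (mu : {finite_measure set T -> \bar R}) (nu : set T -> dual W).
Hypothesis nuD : countably_additive nu.
Hypothesis numu : measure_continuous mu nu.

Local Notation mass A := (fine (mu A)).
Local Notation density := (density nuD numu).

(** P is the set where the density of nu at x is at least c.  The limit
    arguments compare densities through these two inequalities, because the
    measures are exactly linear in x, whereas densities are so only almost
    everywhere. *)
Lemma vector_measure_slice x (c : R) : exists P, [/\ measurable P,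
  forall A, measurable A -> A `<=` P -> c * mass A <= nu A x &
  forall A, measurable A -> A `<=` ~` P -> nu A x <= c * mass A].
Proof.
exists [set w | c <= density x w]; split.
- apply: measurable_le_set; first exact: measurable_cst.
  exact: measurable_density.
- move=> A mA Ac; rewrite (integral_density nuD numu)//.
  by apply: le_integral_mass => //; exact: integrable_density.
- move=> A mA Ac; rewrite (integral_density nuD numu)//.
  apply: ge_integral_mass => // [|w /Ac /= /negP].
    exact: integrable_density.
  by rewrite -ltNge => /ltW.
Qed.

Lemma density_midpoint x y :
  graph_area mu (density (2^-1 *: (x + y))) =
  graph_area mu (fun w => (density x w + density y w) / 2).
Proof.
have i1 := integrable_density nuD numu x.
have i2 := integrable_density nuD numu y.
have E : (fun w => (density x w + density y w) / 2) =
   (fun w => 2^-1 * (density x w + density y w)).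
  by apply/funext => w; rewrite mulrC.
rewrite E; apply: graph_area_ae.
- exact: integrable_density.
- by apply: integrable_scale; exact: integrable_add.
- move=> A mA; rewrite -integral_density//.
  rewrite RintegralZl ?RintegralD//; try exact: integrable_restr.
    by rewrite -!integral_density// linearZ/= linearD.
  by apply: integrable_restr => //; exact: integrable_add.
Qed.

Definition semivariation_bound : R := projT1 (cid (vector_measure_bounded nuD)).

Lemma semivariation_boundP A : measurable A -> `|nu A| <= semivariation_bound.
Proof. exact: projT2 (cid (vector_measure_bounded nuD)) A. Qed.

Lemma semivariation_bound_ge0 : 0 <= semivariation_bound.
Proof. by apply: le_trans (semivariation_boundP measurable0). Qed.

Lemma normr_vector_measure A x : measurable A -> `|x| <= 1 ->
  `|nu A x| <= semivariation_bound.
Proof.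
move=> mA x1; apply: (le_trans (le_dual_norm (nu A) x)).
by apply: le_trans (semivariation_boundP mA); rewrite ler_piMr// dual_norm_ge0.
Qed.

Lemma integral_normr_density x : `|x| <= 1 ->
  \int[mu]_w `|density x w| <= 2 * semivariation_bound.
Proof.
move=> x1; have intx := integrable_density nuD numu x.
pose P := [set w | 0 <= density x w].
have mP : measurable P.
  apply: measurable_le_set; first exact: measurable_cst.
  exact: measurable_density.
have mP' := measurableC mP.
rewrite (integral_setID mP); last exact: integrable_norm.
rewrite (@eq_Rintegral _ _ _ _ P (density x)); last first.
  by move=> w; rewrite inE => w0; rewrite ger0_norm.
rewrite (@eq_Rintegral _ _ _ _ (~` P) (fun w => (-1) * density x w));
  last first.
  move=> w; rewrite inE => /negP; rewrite -ltNge => w0.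
  by rewrite ltr0_norm// mulN1r.
rewrite RintegralZl//; last exact: integrable_restr.
rewrite -!integral_density//.
have := normr_vector_measure mP x1; have := normr_vector_measure mP' x1.
by rewrite !ler_norml => /andP[h1 h2] /andP[h3 h4]; lra.
Qed.

Definition energy x : R := graph_area mu (density x).

Lemma energy_ge0 x : 0 <= energy x.
Proof. by apply: Rintegral_ge0 => w _; exact: sqrtr_ge0. Qed.

Lemma energy_le x : `|x| <= 1 ->
  energy x <= mass setT + 2 * semivariation_bound.
Proof.
move=> x1; have intx := integrable_density nuD numu x.
have c1 : mu.-integrable setT (EFin \o cst (1 : R)).
  exact: finite_measure_integrable_cst.
have nx : mu.-integrable setT (EFin \o (fun w => `|density x w|)).
  exact: integrable_norm.
apply: (@le_trans _ _ (\int[mu]_w (cst 1 w + `|density x w|))).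
  apply: le_Rintegral => //; first exact: integrable_hypot.
    exact: integrable_add.
  by move=> w _; exact: hypot_le.
rewrite RintegralD// Rintegral_cst// mul1r.
by rewrite lerD2l integral_normr_density.
Qed.

(** The densities at x and y differ by at most e outside a set of measure at
    most e, said without mentioning densities. *)
Definition almost_close x y (e : R) : Prop := exists B, [/\ measurable B,
  mass (~` B) <= e &
  forall A, measurable A -> A `<=` B -> `|nu A (x - y)| <= e * mass A].

(** The number m stands for a common lower bound, up to t, of the energy over a
    convex set containing x and y.  By [graph_area_gap] the densities of x and y
    can then be e-separated only where one of them is large, which happens on a
    small set since their L1 norms are bounded, or on a set of measure at most
    4 t / c, c being the gap of [hypot_midpoint_gap]. *)
Lemma near_minimizers_almost_close (e : R) : 0 < e -> exists2 t : R, 0 < t &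
  forall (m : R) x y, `|x| <= 1 -> `|y| <= 1 -> energy x <= m + t ->
  energy y <= m + t -> m - t <= energy (2^-1 *: (x + y)) -> almost_close x y e.
Proof.
move=> e0.
(* By Chebyshev, a density exceeds K in absolute value on measure <= e / 4. *)
pose K := 8 * semivariation_bound / e + 1.
have K1 : 1 <= K.
  by rewrite /K lerDr divr_ge0 ?(ltW e0)// mulr_ge0// semivariation_bound_ge0.
have K0 : 0 < K by lra.
pose c := e ^+ 2 / (4 * (1 + K) ^+ 3).
have c0 : 0 < c.
  by rewrite divr_gt0 ?exprn_gt0// mulr_gt0// exprn_gt0//; lra.
exists (c * e / 8); first by rewrite divr_gt0// mulr_gt0.
move=> m x y x1 y1 xm ym xym.
have intx := integrable_density nuD numu x.
have inty := integrable_density nuD numu y.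
have mx := measurable_density nuD numu x.
have my := measurable_density nuD numu y.
pose big z := [set w | K <= `|density z w|].
have mbig z : measurable (big z).
  apply: measurable_le_set; first exact: measurable_cst.
  exact/measurable_norm/measurable_density.
have bigle z : `|z| <= 1 -> mass (big z) <= e / 4.
  move=> z1.
  have : K * mass (big z) <= 2 * semivariation_bound.
    apply: le_trans (integral_normr_density z1).
    by apply: ge0_integral_mass => //; exact/integrable_norm/integrable_density.
  have KE : K * (e / 4) = 2 * semivariation_bound + e / 4.
    by rewrite /K; field; rewrite gt_eqF.
  move=> h; rewrite -(ler_pM2l K0) KE; lra.
pose E := gap_set (density x) (density y) K e.
have mE : measurable E by exact: measurable_gap_set.
have Ele : mass E <= e / 2.
  have := graph_area_gap e0 (ltW K0) intx inty.
  rewrite -/E -/c -density_midpoint -/(energy x) -/(energy y) -/(energy _) => h.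
  have : c * mass E <= c * (e / 2) by lra.
  by rewrite ler_pM2l.
exists (~` (big x `|` big y `|` E)); split.
- by apply: measurableC; apply: measurableU => //; exact: measurableU.
- rewrite setCK; apply: (le_trans (massU_le _ _ _)) => //.
    exact: measurableU.
  have := massU_le mu (mbig x) (mbig y).
  have := bigle _ x1; have := bigle _ y1; lra.
- move=> A mA AB.
  rewrite linearB/= !(integral_density nuD numu)// -RintegralB//;
    try exact: integrable_restr.
  have intxy :
      mu.-integrable setT (EFin \o (fun w => density x w - density y w)).
    exact: (integrableB _ intx inty).
  apply: (le_trans (le_normr_Rintegral _ _)) => //.
    exact: integrable_restr.
  apply: ge_integral_mass => //; first exact: (integrable_norm intxy).
  move=> w /AB; rewrite /setC/= => nw.
  rewrite leNgt; apply/negP => /ltW ew; apply: nw.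
  have [Kx|xK] := leP K `|density x w|; first by left; left.
  have [Ky|yK] := leP K `|density y w|; first by left; right.
  by right; split=> //; exact: ltW.
Qed.

End near_minimizers.

(** * Average points and weak-star limits *)
Section average_points.
Context {d : measure_display} {T : measurableType d} {R : realType}.
Context {X : normedModType R}.
Variables (mu : {finite_measure set T -> \bar R}) (nu : set T -> dual (dual X)).

Local Notation mass A := (fine (mu A)).

(** The values at v are averages over A in the sense that every lower bound for
    the density at z on A is a lower bound for z v; replacing z by - z, the same
    holds for upper bounds. *)
Definition average_point (A : set T) (v : X) : Prop :=
  forall (z : dual X) (c : R),
  (forall B, measurable B -> B `<=` A -> c * mass B <= nu B z) -> c <= z v.

Lemma halfspace_convex (z : dual X) (c : R) :
  convex_set [set psi : dual (dual X) | c <= psi z].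
Proof.
move=> f g t; rewrite !inE /= => cf cg.
change (c <= t%:num * f z + (1 - t%:num) * g z).
have t0 : 0 <= t%:num by exact: ge0.
have t1 : t%:num <= 1 by exact: le1.
have := ler_wpM2l t0 cf.
have t1' : 0 <= 1 - t%:num by rewrite subr_ge0.
by have := ler_wpM2l t1' cg; lra.
Qed.

(** The half-space of the psi with c <= psi z is convex and weak-star closed,
    and it contains the average range. *)
Lemma closure_average_range_ge (A : set T) (z : dual X) (c : R) psi :
  (forall B, measurable B -> B `<=` A -> c * mass B <= nu B z) ->
  weak_star_closure (convex_hull (average_range mu nu A)) psi -> c <= psi z.
Proof.
move=> cA cl.
have hull : convex_hull (average_range mu nu A) `<=` [set f | c <= f z].
  apply: smallest_sub; first exact: halfspace_convex.
  move=> _ [B [mB BA B0] <-] /=.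
  change (c <= (fine (mu B))^-1 * nu B z).
  by rewrite ler_pdivlMl ?fine_gt0 ?B0 ?ltey_eq ?fin_num_measure// mulrC cA.
rewrite leNgt; apply/negP => zc.
have near_psi : nbhs (psi : weak_star (dual X))
    [set g : weak_star (dual X) | (g : dual (dual X)) z < c].
  have cz : (fun g : dual (dual X) => g z) @ nbhs (psi : weak_star (dual X)) -->
      (psi z : R^o).
    apply: (weak_star_cvgP (psi : weak_star (dual X)) (nbhs_filter _)).1.
    exact: cvg_id.
  exact: (cvgr_lt _ cz _ zc).
have [g [/hull /= cg gc]] := cl _ near_psi.
by move: gc; rewrite /= ltNge cg.
Qed.

Lemma exists_average_point (A : set T) :
  weak_star_closure (convex_hull (average_range mu nu A))
      `&` range (@to_bidual R X) !=set0 ->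
  exists v, average_point A v.
Proof.
move=> [psi [cl [v _ vpsi]]]; exists v => z c cA.
by have := closure_average_range_ge cA cl; rewrite -vpsi.
Qed.

End average_points.

Section weak_star_limits.
Context {d : measure_display} {T : measurableType d} {R : realType}.
Context {X : normedModType R}.
Variables (mu : {finite_measure set T -> \bar R}) (nu : set T -> dual (dual X)).
Hypothesis nuD : countably_additive nu.
Hypothesis numu : measure_continuous mu nu.
Hypothesis nu_avg : forall A, measurable A -> 0 < fine (mu A) ->
  exists v, average_point mu nu A v.

Local Notation mass A := (fine (mu A)).
Local Notation almost_close := (almost_close mu nu).

Let nuID := vector_measureID nuD.

Lemma mass_ge0 A : 0 <= mass A.
Proof. by rewrite fine_ge0. Qed.

(** An upper bound c, uniform in k, on G for the densities at w_k passes to the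
    weak-star limit w, although x |-> nu A x is not known to be weak-star
    continuous.  If the density at w were at least c + e on a subset Q of G of
    positive measure, an average point v of Q would satisfy
    w v - w_k v >= e for all large k. *)
Lemma weak_star_limit_le (w_ : nat -> dual X) (w : dual X) (N : nat)
    (G : set T) (c : R) : 0 <= c -> measurable G ->
  (forall v, w_ k v @[k --> \oo] --> (w v : R^o)) ->
  (forall k, (N <= k)%N -> forall A, measurable A -> A `<=` G ->
    nu A (w_ k) <= c * mass A) ->
  forall A, measurable A -> A `<=` G -> nu A w <= c * mass A.
Proof.
move=> c0 mG wcv wle.
have key e A : 0 < e -> measurable A -> A `<=` G -> nu A w <= (c + e) * mass A.
  move=> e0 mA AG.
  have [P [mP Pge Ple]] := vector_measure_slice nuD numu w (c + e).
  have mQ : measurable (P `&` G) by exact: measurableI.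
  have Q0 : mass (P `&` G) = 0.
    apply/eqP; rewrite eq_le mass_ge0 andbT leNgt; apply/negP => Qpos.
    have [v Qv] := nu_avg mQ Qpos.
    have ge_e k : (N <= k)%N -> e <= w v - w_ k v.
      move=> Nk; apply: (Qv (w - w_ k)) => B mB BQ.
      rewrite linearB/=.
      have := Pge B mB (subset_trans BQ (@subIsetl _ _ _)).
      have := wle k Nk B mB (subset_trans BQ (@subIsetr _ _ _)).
      by lra.
    have /cvgrPdist_lt/(_ e e0)[M _ hM] := wcv v.
    have := hM (maxn M N) (leq_maxl _ _) => /=.
    have := ge_e (maxn M N) (leq_maxr _ _).
    move=> h1 h2; have := le_lt_trans (le_trans h1 (ler_norm _)) h2.
    by rewrite ltxx.
  have mAP : measurable (A `&` P) by exact: measurableI.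
  have AP0 : nu (A `&` P) = 0.
    apply: (vector_measure_null numu) => //; apply/eqP.
    rewrite eq_le mass_ge0 andbT -Q0; apply: le_mass => //.
    by move=> t [At Pt]; split=> //; exact: AG.
  rewrite (nuID mA mP) dualDE AP0 add0r.
  have mAD : measurable (A `\` P) by exact: measurableD.
  apply: (le_trans (Ple _ mAD _)); first by move=> t [].
  apply: ler_wpM2l; first by rewrite addr_ge0// ltW.
  by apply: le_mass => // t [].
move=> A mA AG; apply/ler_addgt0Pl => e e0.
have m1 : 0 < mass A + 1 by rewrite ltr_wpDl// mass_ge0.
have := key (e / (mass A + 1)) A; rewrite divr_gt0// => /(_ isT mA AG).
move/le_trans; apply; rewrite mulrDl addrC lerD2r.
rewrite -mulrA ler_piMr ?(ltW e0)// mulrC ler_pdivrMr// mul1r.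
by rewrite lerDl.
Qed.

Lemma normr_vector_measureB_le (x y : dual X) (A : set T) (r : R) :
  nu A (x - y) <= r -> nu A (y - x) <= r -> `|nu A (x - y)| <= r.
Proof. by rewrite -(opprB x y) linearN/= ler_norml lerNl => -> ->. Qed.

Hypothesis dual_compact : dual_ball_convex_block_compact X.

(** Off the union of the exceptional sets of index at least n, the densities at
    the y_m with m >= n all lie within 2 * 2^-n of the one at y_n.  This passes
    to convex blocks by linearity and then to their weak-star limit by
    [weak_star_limit_le]. *)
Lemma almost_close_limit (y : nat -> dual X) :
  (forall k, `|y k| <= 1) ->
  (forall k, almost_close (y k) (y k.+1) (2^-1 ^+ k)) ->
  exists z : dual X, (forall v, (forall k, y k v = 0) -> z v = 0) /\
  forall n, almost_close (y n) z (2 * 2^-1 ^+ n).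
Proof.
move=> y1 /choice[B hB].
have [h [I [a [a0 Ilt a1 hE]]] [f hf]] := dual_compact y1.
have hfv v : h k v @[k --> \oo] --> ((f : dual X) v : R^o).
  exact: (weak_star_cvgP f _).1 hf v.
(* The blocks are nonempty and successive, so the k-th one starts after k. *)
have Ige k n : n \in I k -> (k <= n)%N.
  elim: k n => [//|k IH] n nI.
  have [m mI] : exists m, m \in I k.
    have [E|] := eqVneq (I k) fset0; last by move=> /fset0Pn.
    have := a1 k; rewrite E big_nil => /esym/eqP.
    by rewrite oner_eq0.
  exact: leq_ltn_trans (IH _ mI) (Ilt _ _ _ mI nI).
exists f; split=> [v yv0|n].
  have h0 k : h k v = 0.
    rewrite hE (big_morph (fun g : dual X => g v) (id1 := 0) (op1 := +%R))//.
    by rewrite big1// => i _; rewrite dualZE yv0 mulr0.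
  apply: (@cvg_unique _ _ _ _ _ _ (hfv v)) => //.
  have -> : (fun k => h k v) = (fun=> 0) by apply/funext => k; rewrite h0.
  exact: cvg_cst.
pose G := ~` \bigcup_k ~` B (n + k)%N.
have mB k : measurable (B k) by have [] := hB k.
have mbad : measurable (\bigcup_k ~` B (n + k)%N).
  by apply: bigcupT_measurable => k; exact: measurableC.
have mG : measurable G by exact: measurableC.
have GB k : G `<=` B (n + k)%N.
  by move=> t Gt; apply: contrapT => nB; apply: Gt; exists k.
have r0 : (0 : R) <= 2 * 2^-1 ^+ n by rewrite mulr_ge0// exprn_ge0.
have chain k A : measurable A -> A `<=` G ->
    `|nu A (y n - y (n + k)%N)| <=
      (2 * 2^-1 ^+ n - 2 * 2^-1 ^+ (n + k)) * mass A.
  move=> mA AG; elim: k => [|k IH].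
    by rewrite addn0 !subrr mul0r linear0 normr0.
  have -> : y n - y (n + k.+1)%N =
      (y n - y (n + k)%N) + (y (n + k)%N - y (n + k.+1)%N).
    by rewrite addrA subrK.
  rewrite linearD; apply: (le_trans (ler_normD _ _)).
  have [_ _ /(_ A mA (subset_trans AG (GB k)))] := hB (n + k)%N.
  rewrite addnS exprS => h1.
  have -> : (2 * 2^-1 ^+ n - 2 * (2^-1 * 2^-1 ^+ (n + k))) * mass A =
      (2 * 2^-1 ^+ n - 2 * 2^-1 ^+ (n + k)) * mass A +
      2^-1 ^+ (n + k) * mass A by field.
  exact: lerD.
have block k A : (n <= k)%N -> measurable A -> A `<=` G ->
    `|nu A (y n - h k)| <= 2 * 2^-1 ^+ n * mass A.
  move=> nk mA AG.
  have -> : y n - h k = \sum_(i <- I k) a i *: (y n - y i).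
    rewrite hE -[y n in LHS]scale1r -(a1 k) scaler_suml -sumrB.
    by apply: eq_bigr => i _; rewrite scalerBr.
  rewrite linear_sum/=; apply: (le_trans (ler_norm_sum _ _ _)).
  rewrite -[leRHS]mul1r -[X in _ <= X * _](a1 k) mulr_suml.
  rewrite big_seq [leRHS]big_seq.
  apply: ler_sum => i iI; rewrite linearZ/= normrM ger0_norm//.
  apply: ler_wpM2l => //.
  have ni : (n <= i)%N := leq_trans nk (Ige _ _ iI).
  rewrite -(subnKC ni); apply: (le_trans (chain _ _ mA AG)).
  apply: ler_wpM2r; first exact: mass_ge0.
  by rewrite lerBlDr lerDl mulr_ge0// exprn_ge0.
exists G; split=> //.
- rewrite /G setCK -lee_fin fineK ?fin_num_measure//.
  apply: (@le_trans _ _ (\sum_(0 <= k <oo) mu (~` B (n + k)%N))%E).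
    by apply: measure_sigma_subadditive => // k; exact: measurableC.
  apply: le_trans (epsilon_trick0 xpredT r0).
  apply: lee_nneseries => // k _.
  rewrite -[leLHS]fineK ?fin_num_measure//; last exact: measurableC.
  have [_ + _] := hB (n + k)%N; rewrite lee_fin => /le_trans; apply.
  rewrite exprD natrX exprS invfM !exprVn.
  rewrite le_eqVlt; apply/orP; left; apply/eqP; field.
  by rewrite !expf_eq0/= !pnatr_eq0 !andbF.
- move=> A mA AG; apply: normr_vector_measureB_le.
    apply: (weak_star_limit_le (w_ := fun k => y n - h k) (N := n)) AG => //.
      by move=> v; apply: cvgB; [exact: cvg_cst|exact: hfv].
    move=> k nk C mC CG; apply: le_trans (ler_norm _) _.
    exact: block.
  apply: (weak_star_limit_le (w_ := fun k => h k - y n) (N := n)) AG => //.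
    by move=> v; apply: cvgB; [exact: hfv|exact: cvg_cst].
  move=> k nk C mC CG; apply: le_trans (ler_norm _) _.
  by rewrite -(opprB (y n)) linearN/= normrN; exact: block.
Qed.

(** Away from the exceptional set the difference is at most r mu(A); on it,
    mu-continuity makes nu small in norm. *)
Lemma almost_close_vector_measure (A : set T) (M e : R) : measurable A ->
  0 <= M -> 0 < e -> exists2 r : R, 0 < r & forall x y s, s <= r ->
  `|x - y| <= M -> almost_close x y s -> `|nu A (x - y)| <= e.
Proof.
move=> mA M0 e0; have M1 : 0 < 2 * (M + 1) by lra.
have [r0 r0p hr0] := numu (divr_gt0 e0 M1).
have m1 : 0 < 2 * (mass setT + 1) by have := mass_ge0 setT; lra.
pose r := Num.min (r0 / 2) (e / (2 * (mass setT + 1))).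
have rp : 0 < r by rewrite lt_min !divr_gt0.
exists r => // x y s sr xyM [B [mB Bs hB]].
rewrite (nuID mA mB) dualDE; apply: (le_trans (ler_normD _ _)).
rewrite [leRHS](splitr e); apply: lerD.
  apply: (le_trans (hB _ _ _)); [exact: measurableI|by move=> t []|].
  apply: (@le_trans _ _ (r * mass setT)).
    apply: ler_pM => //.
    - by apply: le_trans Bs; exact: mass_ge0.
    - exact: mass_ge0.
    - by apply: le_mass => //; exact: measurableI.
  apply: (@le_trans _ _ (e / (2 * (mass setT + 1)) * mass setT)).
    by apply: ler_wpM2r; [exact: mass_ge0|rewrite /r ge_min lexx orbT].
  rewrite mulrAC ler_pdivrMr//; have := mass_ge0 setT; nra.
have mAB : measurable (A `\` B) by exact: measurableD.
apply: (le_trans (le_dual_norm _ _)).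
have small : `|nu (A `\` B)| <= e / (2 * (M + 1)).
  apply/ltW/hr0 => //; rewrite -[ltLHS]fineK ?fin_num_measure// lte_fin.
  have mBC := measurableC mB.
  have : mass (A `\` B) <= r0 / 2.
    apply: (@le_trans _ _ (mass (~` B))); first by apply: le_mass => // t [].
    by apply: (le_trans Bs); apply: (le_trans sr); rewrite /r ge_min lexx.
  by lra.
apply: (@le_trans _ _ (e / (2 * (M + 1)) * M)).
  by apply: ler_pM => //; exact: dual_norm_ge0.
by rewrite mulrAC ler_pdivrMr//; nra.
Qed.

Lemma almost_close_cvg0 (A : set T) (M : R) (x y : nat -> dual X)
    (s : nat -> R) :
  measurable A -> (forall n, `|x n - y n| <= M) -> s n @[n --> \oo] --> 0 ->
  (forall n, almost_close (x n) (y n) (s n)) ->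
  nu A (x n - y n) @[n --> \oo] --> (0 : R^o).
Proof.
move=> mA xyM s0 xys; have M0 : 0 <= M by apply: le_trans (xyM 0%N).
apply/cvgr0Pnorm_le => e e0.
have [r r0 hr] := almost_close_vector_measure mA M0 e0.
have [N _ hN] := (cvgr0Pnorm_lt _).1 s0 r r0.
exists N => // n /= Nn; apply: hr (xyM n) (xys n).
exact: le_trans (ler_norm _) (ltW (hN n Nn)).
Qed.

End weak_star_limits.

(** * Near-minimizers over a decreasing family of convex sets *)
Section minimizing_sequences.
Context {d : measure_display} {T : measurableType d} {R : realType}.
Context {W : normedModType R} {nu : set T -> dual W}.
Variables (mu : {finite_measure set T -> \bar R}).
Hypothesis nuD : countably_additive nu.
Hypothesis numu : measure_continuous mu nu.
Variables (I : choiceType) (C : seq I -> set W).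
Hypothesis C_neq0 : forall s, C s !=set0.
Hypothesis C_ball : forall s x, C s x -> `|x| <= 1.
Hypothesis C_midpoint : forall s x y, C s x -> C s y -> C s (2^-1 *: (x + y)).
Hypothesis C_anti : forall s t, {subset s <= t} -> C t `<=` C s.

Local Notation energy := (energy nuD numu).
Local Notation almost_close := (almost_close mu nu).

Let inf_energy s : R := inf [set energy x | x in C s].
(** The infima increase along the directed family, so their supremum is also
    their limit. *)
Let limit_energy : R := sup [set inf_energy s | s in setT].

Let has_inf_energy s : has_inf [set energy x | x in C s].
Proof.
split; first by have [x Cx] := C_neq0 s; exists (energy x), x.
by exists 0 => _ [x _ <-]; exact: energy_ge0.
Qed.

Let inf_energy_le s x : C s x -> inf_energy s <= energy x.
Proof.
by move=> Cx; apply: ge_inf; [exact: (has_inf_energy s).2|exists x].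
Qed.

Let has_limit_energy : has_sup [set inf_energy s | s in setT].
Proof.
split; first by exists (inf_energy [::]), [::].
exists (fine (mu setT) + 2 * semivariation_bound nuD) => _ [s _ <-].
have [x Cx] := C_neq0 s; apply: (le_trans (inf_energy_le Cx)).
exact/energy_le/C_ball/Cx.
Qed.

Let exists_energy_le s (t : R) : 0 < t ->
  exists2 x, C s x & energy x <= limit_energy + t.
Proof.
move=> t0; have [_ [x Cx <-] xt] := inf_adherent t0 (has_inf_energy s).
exists x => //; apply/ltW/(lt_le_trans xt); rewrite lerD2r.
by apply: ub_le_sup; [exact: has_limit_energy.2|exists s].
Qed.

Let exists_energy_ge (t : R) : 0 < t ->
  exists s, forall x, C s x -> limit_energy - t <= energy x.
Proof.
move=> t0; have [_ [s _ <-] st] := sup_adherent t0 has_limit_energy.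
exists s => x Cx; apply: (le_trans (ltW st)); exact: inf_energy_le.
Qed.

(** N k consists of the points of C (S k) with energy at most
    [limit_energy] + t k, where S k is so large that the infimum over C (S k)
    is at least [limit_energy] - t k.  Since no C s has infimum above
    [limit_energy], arbitrary further constraints s are compatible with
    membership in finitely many of the N k. *)
Lemma exists_near_minimizers (e : nat -> R) : (forall k, 0 < e k) ->
  exists N : nat -> set W,
  (forall k s, exists2 x, C s x & forall j, (j <= k)%N -> N j x) /\
  (forall k x y, N k x -> N k y -> almost_close x y (e k)).
Proof.
move=> e0.
have /choice[t ht] k : exists t : R, 0 < t /\ forall m x y,
    `|x| <= 1 -> `|y| <= 1 -> energy x <= m + t -> energy y <= m + t ->
    m - t <= energy (2^-1 *: (x + y)) -> almost_close x y (e k).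
  have [t t0 ht] := near_minimizers_almost_close nuD numu (e0 k).
  by exists t; split.
have /choice[S hS] k := exists_energy_ge (ht k).1.
pose N k := [set x | C (S k) x /\ energy x <= limit_energy + t k].
exists N; split=> [k s|k x y [Cx ex] [Cy ey]]; last first.
  apply: (ht k).2 ex ey _; [exact: C_ball Cx|exact: C_ball Cy|].
  exact/hS/C_midpoint.
pose r := \big[Num.min/1]_(j < k.+1) t j.
have r0 : 0 < r.
  rewrite /r; elim/big_ind : _ => // [a b a0 b0|j _]; last exact: (ht j).1.
  by rewrite lt_min a0.
have [x Cx xr] :=
  exists_energy_le (s ++ flatten [seq S j | j <- iota 0 k.+1]) r0.
exists x => [|j jk].
  by apply: C_anti Cx => i; rewrite mem_cat => ->.
split.
  apply: C_anti Cx => i ij; rewrite mem_cat; apply/orP; right.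
  by apply/flattenP; exists (S j) => //; apply/map_f; rewrite mem_iota.
apply: (le_trans xr); rewrite lerD2l.
have jk' : (j < k.+1)%N by [].
by rewrite /r (bigD1 (Ordinal jk'))//= ge_min lexx.
Qed.

End minimizing_sequences.

(** * Integrals of the vector measure lie in the space *)
Theorem corollary4 (R : realType) (d : measure_display)
    (Omega : measurableType d) (mu : {finite_measure set Omega -> \bar R})
    (X : completeNormedModType R) (nu : set Omega -> dual (dual X)) :
  dual_ball_convex_block_compact X ->
  countably_additive nu ->
  measure_continuous mu nu ->
  (forall A : set Omega, measurable A -> (0 < mu A)%E ->
    weak_star_closure (convex_hull (average_range mu nu A))
      `&` range (@to_bidual R X) !=set0) ->
  nu @` measurable `<=` range (@to_bidual R X).
Proof.
move=> dual_compact nuD numu avg _ [E mE <-].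
have nu_avg A : measurable A -> 0 < fine (mu A) ->
    exists v, average_point mu nu A v.
  move=> mA A0; apply/exists_average_point/avg => //.
  by rewrite -[ltRHS]fineK ?fin_num_measure// lte_fin.
apply: range_to_bidual_annihilator => e e0; apply: contrapT => /forallNP noF.
pose C (s : seq X) := [set f : dual X |
  [/\ `|f| <= 1, forall v, v \in s -> f v = 0 & e <= nu E f] ].
have C_neq0 s : C s !=set0.
  apply: contrapT => C0; apply: (noF s) => f f1 fs.
  by rewrite leNgt; apply/negP => /ltW ef; apply: C0; exists f.
have C_ball s f : C s f -> `|f| <= 1 by case.
have C_midpoint s f g : C s f -> C s g -> C s (2^-1 *: (f + g)).
  move=> [f1 fs fe] [g1 gs ge]; split=> [|v vs|].
  - rewrite normrZ ger0_norm ?invr_ge0//.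
    by have := ler_normD f g; rewrite ler_pdivrMl//; lra.
  - by rewrite dualZE dualDE fs// gs// addr0 mulr0.
  - by rewrite linearZ/= linearD /GRing.scale/= ler_pdivlMl//; lra.
have C_anti s t : {subset s <= t} -> C t `<=` C s.
  by move=> st f [f1 ft fe]; split=> // v /st; exact: ft.
have [k|N [N_neq0 N_close]] := exists_near_minimizers nuD numu C_neq0 C_ball
    C_midpoint C_anti (e := fun k => 2^-1 ^+ k); first by rewrite exprn_gt0.
(* One sequence of near-minimizers for each extra constraint y v = 0; any two
   of them are asymptotically close by [N_close]. *)
have seq_limit v : exists (y : nat -> dual X) (z : dual X),
    [/\ forall k, N k (y k) /\ C [:: v] (y k),
    z v = 0 & forall n, almost_close mu nu (y n) z (2 * 2^-1 ^+ n)].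
  have /choice[y hy] k : exists y, C [:: v] y /\ forall j, (j <= k)%N -> N j y.
    by have [y Cy Ny] := N_neq0 k [:: v]; exists y.
  have [k|k|z [z0 yz]] :=
    almost_close_limit nuD numu nu_avg dual_compact (y := y).
  - exact/C_ball/(hy k).1.
  - by apply: N_close; [exact: (hy k).2|exact: (hy k.+1).2].
  exists y, z; split=> // [k|].
    by split; [exact: (hy k).2|exact: (hy k).1].
  by apply: z0 => k; have [[_ + _] _] := hy k; apply; rewrite mem_seq1.
have pow0 : (2^-1 ^+ n : R) @[n --> \oo] --> 0.
  by apply: cvg_expr; rewrite ger0_norm// invf_lt1 ?ltr1n.
have pow0' : (2 * 2^-1 ^+ n : R) @[n --> \oo] --> 0.
  by rewrite -[X in _ --> X](mulr0 2); apply: cvgM pow0; exact: cvg_cst.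
have ball_dist (f g : dual X) : `|f| <= 1 -> `|f - g| <= 1 + `|g|.
  by move=> f1; apply: (le_trans (ler_normB _ _)); rewrite lerD2r.
have to_limit A y z : measurable A -> (forall k, `|y k| <= 1) ->
    (forall n, almost_close mu nu (y n) z (2 * 2^-1 ^+ n)) ->
    nu A (y n - z) @[n --> \oo] --> (0 : R^o).
  move=> mA y1 yz; apply: (almost_close_cvg0 nuD numu mA _ pow0' yz) => n.
  exact: ball_dist (y1 n).
have [y [z [hy _ yz]]] := seq_limit 0.
have y1 k : `|y k| <= 1 by have [_ /C_ball] := hy k.
have nuEz : e <= nu E z.
  rewrite -subr_le0; apply: (cvgr_to_ge (to_limit E y z mE y1 yz)).
  apply: nearW => n; have [_ [_ _ ey]] := hy n.
  by rewrite linearB/= lerD2r.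
(* All the limits define the same measure, hence have the same density. *)
have nu_eq v z' y' A : (forall k, N k (y' k) /\ C [:: v] (y' k)) ->
    (forall n, almost_close mu nu (y' n) z' (2 * 2^-1 ^+ n)) -> measurable A ->
    nu A z' = nu A z.
  move=> hy' yz' mA.
  have y1' k : `|y' k| <= 1 by have [_ /C_ball] := hy' k.
  have yy' : nu A (y' n - y n) @[n --> \oo] --> (0 : R^o).
    apply: (almost_close_cvg0 nuD numu (M := 2) mA _ pow0) => n; last first.
      by apply: N_close; [have [] := hy' n|have [] := hy n].
    by apply: (le_trans (ball_dist _ _ (y1' n))); have := y1 n; lra.
  have lim0 : nu A (y' n - y n) - nu A (y' n - z') + nu A (y n - z)
      @[n --> \oo] --> (0 - 0 + 0 : R^o).
    apply: cvgD; last exact: to_limit mA y1 yz.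
    by apply: cvgB => //; exact: to_limit mA y1' yz'.
  rewrite subr0 addr0 in lim0.
  apply/subr0_eq; apply: (@cvg_unique _ _ _ _ _ _ _ lim0) => //.
  apply: cvg_near_cst; apply: nearW => n; apply/eqP.
  have nuB f g : nu A (f - g) = nu A f - nu A g by rewrite linearB.
  by rewrite !nuB opprB [X in X + _]addrC !subrKA.
(* This c satisfies c mu(Omega) < e <= nu E z, so the density at z is at least
   c on a set P of positive measure. *)
have m1 : 0 < fine (mu setT) + 1 by rewrite ltr_wpDl// mass_ge0.
pose c := e / (fine (mu setT) + 1).
have c0 : 0 < c by rewrite divr_gt0.
have [P [mP Pge Ple]] := vector_measure_slice nuD numu z c.
have Ppos : 0 < fine (mu P).
  rewrite lt_neqAle mass_ge0 andbT; apply/eqP => P0.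
  have mEP : measurable (E `&` P) by exact: measurableI.
  have mED : measurable (E `\` P) by exact: measurableD.
  have EP0 : nu (E `&` P) = 0.
    apply: (vector_measure_null numu) => //; apply/eqP.
    by rewrite eq_le mass_ge0 andbT P0; apply: le_mass => // t [].
  move: nuEz; rewrite (vector_measureID nuD mE mP) dualDE EP0 add0r leNgt.
  move/negP; apply; apply: (le_lt_trans (Ple _ mED _)); first by move=> t [].
  apply: (@le_lt_trans _ _ (c * fine (mu setT))).
    by apply: ler_wpM2l; [exact: ltW|exact: le_mass].
  by rewrite /c mulrAC ltr_pdivrMr//; nra.
(* The contradiction: v is an average point of P, and z' vanishes at v. *)
have [v Pv] := nu_avg P mP Ppos.
have [y' [z' [hy' z'v yz']]] := seq_limit v.
have : c <= z' v.
  by apply: Pv => B mB BP; rewrite (nu_eq v z' y' B)//; exact: Pge.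
by rewrite z'v leNgt c0.
Qed.
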